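(* Let $n\geq 0$ be an integer and let $x$ be a complex number for which every denominator and every base raised to a negative power below is nonzero (this is the case whenever $x\notin\{0,\pm1,\pm\tfrac{1}{\sqrt2},\pm 2i,\pm i\sqrt2\}$). Then the following twelve identities hold: (1) $\displaystyle\sum_{k=0}^{n-1}\binom{n}{k}\Bigl(\frac{\sqrt{x^2+4}(2x^2-1)}{x}\Bigr)^{n-k-1}\bigl(1-(-1)^{n-k}\bigr)T_{2k}(x)=\sum_{k=1}^{n}\binom{n}{k}\Bigl(\frac{4x^2-2}{x}\Bigr)^{k-1}\bigl(2x\sqrt{x^2-1}\bigr)^{n-k}\bigl(1+(-1)^{n-k}\bigr)F_{k}(x)$; (2) $\displaystyle\sum_{k=0}^{n}\binom{n}{k}\Bigl(\frac{\sqrt{x^2+4}(2x^2-1)}{x}\Bigr)^{n-k-1}\bigl(1-(-1)^{n-k}\bigr)U_{2k}(x)=2x\sum_{k=1}^{n}\binom{n}{k}\Bigl(\frac{4x^2-2}{x}\Bigr)^{k-1}\bigl(2x\sqrt{x^2-1}\bigr)^{n-k-1}\bigl(\alpha(x)-(-1)^{n-k}\beta(x)\bigr)F_{k}(x)$; (3) $\displaystyle\sum_{k=0}^{n}\binom{n}{k}\Bigl(\frac{\sqrt{x^2+4}(2x^2-1)}{x}\Bigr)^{n-k-1}\bigl(1-(-1)^{n-k}\bigr)T_{2k+1}(x)=\sum_{k=1}^{n}\binom{n}{k}\Bigl(\frac{4x^2-2}{x}\Bigr)^{k-1}\bigl(2x\sqrt{x^2-1}\bigr)^{n-k}\bigl(\alpha(x)+(-1)^{n-k}\beta(x)\bigr)F_{k}(x)$;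 (4) $\displaystyle\sum_{k=0}^{n}\binom{n}{k}\Bigl(\frac{\sqrt{x^2+4}(2x^2-1)}{x}\Bigr)^{n-k-1}\bigl(1-(-1)^{n-k}\bigr)U_{2k+1}(x)=2x\sum_{k=1}^{n}\binom{n}{k} \Bigl(\frac{4x^2-2}{x}\Bigr)^{k-1}\bigl(2x\sqrt{x^2-1}\bigr)^{n-k-1}\bigl(\alpha^2(x)-(-1)^{n-k}\beta^2(x)\bigr)F_{k}(x)$; (5) $\displaystyle x\sum_{k=0}^{n}\binom{n}{k}\Bigl(\frac{x^2+2}{2x}\Bigr)^k \Bigl(\frac{x\sqrt{x^2+4}}{2}\Bigr)^{n-k-1}\bigl(\rho(x)-(-1)^{n-k}\sigma(x)\bigr)T_{k}(x)=\sum_{k=0}^{n}\binom{n}{k}\Bigl(\frac{(x^2+2)\sqrt{x^2-1}}{2x}\Bigr)^{n-k}\bigl(1+(-1)^{n-k}\bigr)F_{2k+1}(x)$; (6) $\displaystyle x\sum_{k=0}^{n}\binom{n}{k}\Bigl(\frac{x^2+2}{2x}\Bigr)^{k-1}\Bigl(\frac{x\sqrt{x^2+4}}{2}\Bigr)^{n-k-1}\bigl(\rho(x)-(-1)^{n-k}\sigma(x)\bigr)U_{k}(x)=\sum_{k=0}^{n}\binom{n}{k} \Bigl(\frac{(x^2+2)\sqrt{x^2-1}}{2x}\Bigr)^{n-k-1}\bigl(\alpha(x)-(-1)^{n-k}\beta(x)\bigr)F_{2k+1}(x)$; (7) $\displaystyle x\sum_{k=0}^{n}\binom{n}{k}\Bigl(\frac{x^2+2}{2x}\Bigr)^k\Bigl(\frac{x\sqrt{x^2+4}}{2}\Bigr)^{n-k-1}\bigl(1-(-1)^{n-k}\bigr)T_{k}(x)=\sum_{k=1}^{n}\binom{n}{k}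 \Bigl(\frac{(x^2+2)\sqrt{x^2-1}}{2x}\Bigr)^{n-k}\bigl(1+(-1)^{n-k}\bigr)F_{2k}(x)$; (8) $\displaystyle x\sum_{k=0}^{n}\binom{n}{k} \Bigl(\frac{x^2+2}{2x}\Bigr)^{k-1}\Bigl(\frac{x\sqrt{x^2+4}}{2}\Bigr)^{n-k-1}\bigl(1-(-1)^{n-k}\bigr)U_{k}(x)=\sum_{k=0}^{n}\binom{n}{k} \Bigl(\frac{(x^2+2)\sqrt{x^2-1}}{2x}\Bigr)^{n-k-1} \bigl(\alpha(x)-(-1)^{n-k}\beta(x)\bigr)F_{2k}(x)$; (9) $\displaystyle x\sum_{k=0}^{n}\binom{n}{k} \Bigl(\frac{x^2+2}{4x^2-2}\Bigr)^{k}\Bigl(\frac{x\sqrt{x^2+4}}{2}\Bigr)^{n-k-1}\bigl(1-(-1)^{n-k}\bigr)T_{2k+1}(x)=\sum_{k=0}^{n}\binom{n}{k}\Bigl(\frac{x(x^2+2)\sqrt{x^2-1}}{2x^2-1}\Bigr)^{n-k} \bigl(\alpha(x)+(-1)^{n-k}\beta(x)\bigr)F_{2k}(x)$; (10) $\displaystyle \sum_{k=0}^{n}\binom{n}{k} \Bigl(\frac{x^2+2}{4x^2-2}\Bigr)^{k-1}\Bigl(\frac{x\sqrt{x^2+4}}{2}\Bigr)^{n-k-1}\bigl(1-(-1)^{n-k}\bigr)U_{2k+1}(x)=2\sum_{k=0}^{n}\binom{n}{k} \Bigl(\frac{x(x^2+2)\sqrt{x^2-1}}{2x^2-1}\Bigr)^{n-k-1}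 \bigl(\alpha^2(x)-(-1)^{n-k}\beta^2(x)\bigr)F_{2k}(x)$; (11) $\displaystyle x\sum_{k=0}^{n}\binom{n}{k}\Bigl(\frac{x^2+2}{4x^2-2}\Bigr)^{k}\Bigl(\frac{x\sqrt{x^2+4}}{2}\Bigr)^{n-k-1}\bigl(\rho(x)-(-1)^{n-k}\sigma(x)\bigr)T_{2k}(x)=\sum_{k=0}^{n}\binom{n}{k} \Bigl(\frac{x(x^2+2)\sqrt{x^2-1}}{2x^2-1}\Bigr)^{n-k} \bigl(1+(-1)^{n-k}\bigr)F_{2k+1}(x)$; (12) $\displaystyle \sum_{k=0}^{n}\binom{n}{k} \Bigl(\frac{x^2+2}{4x^2-2}\Bigr)^{k-1}\Bigl(\frac{x\sqrt{x^2+4}}{2}\Bigr)^{n-k-1}\bigl(\rho(x)-(-1)^{n-k}\sigma(x)\bigr)U_{2k}(x)=2\sum_{k=0}^{n}\binom{n}{k} \Bigl(\frac{x(x^2+2)\sqrt{x^2-1}}{2x^2-1}\Bigr)^{n-k-1} \bigl(\alpha(x)-(-1)^{n-k}\beta(x)\bigr)F_{2k+1}(x)$.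
   Context: The Chebyshev polynomials of the first kind $T_n(x)$ and of the second kind $U_n(x)$ are defined by $T_0(x)=1$, $T_1(x)=x$, $T_{n+1}(x)=2xT_n(x)-T_{n-1}(x)$, and $U_0(x)=1$, $U_1(x)=2x$, $U_{n+1}(x)=2xU_n(x)-U_{n-1}(x)$ for $n\ge 1$. The (Catalan) Fibonacci polynomials $F_n(x)$ are defined by $F_0(x)=0$, $F_1(x)=1$, $F_n(x)=xF_{n-1}(x)+F_{n-2}(x)$ for $n\geq 2$. Put $\alpha(x)=x+\sqrt{x^2-1}$, $\beta(x)=x-\sqrt{x^2-1}$, $\rho(x)=\frac{x+\sqrt{x^2+4}}{2}$, $\sigma(x)=\frac{x-\sqrt{x^2+4}}{2}$; $\alpha^2(x)=(\alpha(x))^2$ and $\beta^2(x)=(\beta(x))^2$. Here $\sqrt{x^2-1}$ and $\sqrt{x^2+4}$ denote fixed complex square roots, the same choice being used throughout. Conventions: $0^0=1$, and a sum whose upper limit is smaller than its lower limit is $0$. *)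

(* Defs.v *)
From HB Require Import structures.
From mathcomp Require Import all_boot all_order all_algebra.
From mathcomp Require Import reals.
From mathcomp.real_closed Require Import complex.

Set Implicit Arguments.
Unset Strict Implicit.
Unset Printing Implicit Defensive.

Import Order.TTheory GRing.Theory Num.Theory.

Local Open Scope ring_scope.

Section Polynomials.
Variable A : nzRingType.

Fixpoint chebT (n : nat) : {poly A} :=
  match n with
  | 0 => 1
  | n1.+1 => match n1 with
             | 0 => 'X
             | n2.+1 => 2 * 'X * chebT n1 - chebT n2
             end
  end.

Fixpoint chebU (n : nat) : {poly A} :=
  match n with
  | 0 => 1
  | n1.+1 => match n1 with
             | 0 => 2 * 'X
             | n2.+1 => 2 * 'X * chebU n1 - chebU n2
             end
  end.

Fixpoint fibp (n : nat) : {poly A} :=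
  match n with
  | 0 => 0
  | n1.+1 => match n1 with
             | 0 => 1
             | n2.+1 => 'X * fibp n1 + fibp n2
             end
  end.

End Polynomials.

Arguments chebT {A} n%_N.
Arguments chebU {A} n%_N.
Arguments fibp {A} n%_N.

Section Complexes.
Variable R : realType.

(* Throughout, [s] is the chosen square root of x^2 - 1 and [t] the chosen
   square root of x^2 + 4. *)
Implicit Types x s t : R[i].

Definition alpha x s : R[i] := x + s.
Definition beta x s : R[i] := x - s.
Definition rho x t : R[i] := (x + t) / 2.
Definition sigma x t : R[i] := (x - t) / 2.

(* The first four conditions are on denominators, the other seven on the bases
   that get raised to the power n - k - 1 (with k = n) or k - 1 (with k = 0). *)
Definition admissible x s t : bool :=
  [&& x != 0,
      2 * x != 0,
      2 * x ^+ 2 - 1 != 0,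
      4 * x ^+ 2 - 2 != 0,
      t * (2 * x ^+ 2 - 1) / x != 0,
      2 * x * s != 0,
      x * t / 2 != 0,
      (x ^+ 2 + 2) / (2 * x) != 0,
      (x ^+ 2 + 2) * s / (2 * x) != 0,
      (x ^+ 2 + 2) / (4 * x ^+ 2 - 2) != 0
    & x * (x ^+ 2 + 2) * s / (2 * x ^+ 2 - 1) != 0].

Definition exceptional : seq R[i] :=
  let sqrt2 : R[i] := (Num.sqrt (2 : R))%:C%C in
  let i : R[i] := 'i%C in
  [:: 0; 1; - 1; 1 / sqrt2; - (1 / sqrt2); 2 * i; - (2 * i);
      i * sqrt2; - (i * sqrt2)].

End Complexes.
Arguments exceptional R : clear implicits.

(* Main.v *)
(* With a = alpha, b = beta, p = rho, q = sigma, the Binet formulas turn each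
   side into a binomial sum whose last factor is a combination of two geometric
   sequences, so both sides are sums of four n-th powers.  They agree because
   the scalars u, v, w, z in the powers satisfy
   u a^i + v = w p^j + z,  u a^i - v = w q^j + z,
   u b^i + v = w p^j - z,  u b^i - v = w q^j - z,
   where (i, j) is (2, 1) in (1)-(4), (1, 2) in (5)-(8), (2, 2) in (9)-(12). *)
Require Import Defs.
From HB Require Import structures.
From mathcomp Require Import all_boot all_order all_algebra.
From mathcomp Require Import reals.
From mathcomp Require Import ring.
From mathcomp.real_closed Require Import complex.

Set Implicit Arguments.
Unset Strict Implicit.
Unset Printing Implicit Defensive.

Import Order.TTheory GRing.Theory Num.Theory.

Local Open Scope ring_scope.

(** The sign [(-1) ^+ (n - k)] is absorbed by replacing [z] with [- z], so four applications of the
    binomial theorem give the sum: [e] weights the powers with [+ z], [f] those with [- z]. *)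
Lemma sum_binomial_signed (K : comNzRingType) (n : nat) (a b c d e f z : K) :
  \sum_(0 <= k < n.+1) 'C(n, k)%:R * z ^+ (n - k) *
    (e + (-1) ^+ (n - k) * f) * (c * a ^+ k + d * b ^+ k) =
  c * (e * (a + z) ^+ n + f * (a - z) ^+ n) +
  d * (e * (b + z) ^+ n + f * (b - z) ^+ n).
Proof.
rewrite big_mkord ![a + _]addrC ![b + _]addrC !exprDn !mulr_sumr.
rewrite -!big_split /= !mulr_sumr -big_split /=; apply: eq_bigr => k _.
rewrite -![(_ * _) *+ 'C(n, k)]mulr_natl ![(- z) ^+ _]exprNn.
move: ('C(n, k)%:R) (z ^+ _) ((-1) ^+ _) (a ^+ _) (b ^+ _) => C Z S A B.
by ring.
Qed.

(** By the four relations both sums, scaled by [l], consist of the same four n-th powers, with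
    weights [c * e], [- c * f], [d * e], [- d * f]. The left side groups them by [c], [d] and the
    right side by [e], [f]. The summands are left abstract and given only up to [l], so that
    denominators and negative exponents can be cleared term by term. *)
Lemma sum_binomial_exchange (K : idomainType) (u v w z a b p q : K) :
    u * a + v = w * p + z -> u * a - v = w * q + z ->
    u * b + v = w * p - z -> u * b - v = w * q - z ->
  forall (n : nat) (c d e f l : K) (L R : nat -> K), l != 0 ->
    (forall k, (k <= n)%N -> l * L k =
       'C(n, k)%:R * (u ^+ k * v ^+ (n - k)) *
         (e - (-1) ^+ (n - k) * f) * (c * a ^+ k + d * b ^+ k)) ->
    (forall k, (k <= n)%N -> l * R k =
       'C(n, k)%:R * (w ^+ k * z ^+ (n - k)) *
         (c + (-1) ^+ (n - k) * d) * (e * p ^+ k - f * q ^+ k)) ->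
  \sum_(0 <= k < n.+1) L k = \sum_(0 <= k < n.+1) R k.
Proof.
move=> ap aq bp bq n c d e f l L R l_neq0 LE RE.
apply: (mulfI l_neq0); rewrite !mulr_sumr.
have := sum_binomial_signed n (u * a) (u * b) c d e (- f) v.
have := sum_binomial_signed n (w * p) (w * q) e (- f) c d z.
rewrite ap aq bp bq => sumR sumL.
transitivity (c * (e * (w * p + z) ^+ n + - f * (w * q + z) ^+ n) +
              d * (e * (w * p - z) ^+ n + - f * (w * q - z) ^+ n)).
  rewrite -sumL; apply: eq_big_nat => k /andP[_ le_kn].
  by rewrite LE // !exprMn; ring.
transitivity (e * (c * (w * p + z) ^+ n + d * (w * p - z) ^+ n) +
              - f * (c * (w * q + z) ^+ n + d * (w * q - z) ^+ n)).
  by ring.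
rewrite -sumR; apply: eq_big_nat => k /andP[_ le_kn].
by rewrite RE // !exprMn; ring.
Qed.

(** The exponent is -1 at [k = m]; splitting off that inverse leaves a natural power, the form the
    exchange lemma uses. *)
Lemma exprz_subr1 (K : fieldType) (y : K) (m k : nat) :
  y != 0 -> (k <= m)%N -> y ^ (m%:Z - k%:Z - 1) = y ^+ (m - k) / y.
Proof. by move=> y0 km; rewrite subzn // expfzDr // exprN1. Qed.

Lemma exprz_pred (K : fieldType) (y : K) (k : nat) :
  y != 0 -> y ^ (k%:Z - 1) = y ^+ k / y.
Proof. by move=> y0; rewrite expfzDr // exprN1. Qed.

Section Binet.
Variables (K : comNzRingType) (a b : K).

Lemma linear_rec2_eq (g h : nat -> K) (p q : K) :
  g 0 = h 0 -> g 1 = h 1 ->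
  (forall k, g k.+2 = p * g k.+1 + q * g k) ->
  (forall k, h k.+2 = p * h k.+1 + q * h k) -> g =1 h.
Proof.
move=> e0 e1 gE hE k.
suff [] : g k = h k /\ g k.+1 = h k.+1 by [].
by elim: k => // k [IH0 IH1]; split; rewrite // gE hE IH0 IH1.
Qed.

(** Here [a] and [b] are the roots of y^2 - 2xy + 1, so their powers obey the Chebyshev recurrence
    and two initial values suffice. The formula is free of division, hence valid in any commutative
    ring. *)
Lemma chebT_Binet (x : K) : a + b = 2 * x -> a * b = 1 ->
  forall k, 2 * (chebT k).[x] = a ^+ k + b ^+ k.
Proof.
move=> sab pab; apply: (@linear_rec2_eq _ _ (2 * x) (- 1)) => [|||k].
- by rewrite /= hornerE !expr0; ring.
- by rewrite /= hornerE !expr1.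
- by move=> k; rewrite [chebT k.+2]/= !hornerE /=; ring.
(* Writing the recurrence coefficients as a + b and - ab makes it a polynomial identity in [a] and
   [b]. *)
rewrite -sab -pab !exprS; ring.
Qed.

Lemma chebU_Binet (x : K) : a + b = 2 * x -> a * b = 1 ->
  forall k, (a - b) * (chebU k).[x] = a ^+ k.+1 - b ^+ k.+1.
Proof.
move=> sab pab; apply: (@linear_rec2_eq _ _ (2 * x) (- 1)) => [|||k].
- by rewrite /= hornerE !expr1; ring.
- transitivity ((a - b) * (2 * x)); first by rewrite /= !hornerE /=; ring.
  by rewrite -sab; ring.
- by move=> k; rewrite [chebU k.+2]/= !hornerE /=; ring.
rewrite -sab -pab !exprS; ring.
Qed.

Lemma fibp_Binet (x : K) : a + b = x -> a * b = - 1 ->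
  forall k, (a - b) * (fibp k).[x] = a ^+ k - b ^+ k.
Proof.
move=> sab pab; apply: (@linear_rec2_eq _ _ x 1) => [|||k].
- by rewrite /= hornerE !expr0; ring.
- by rewrite /= hornerE !expr1; ring.
- by move=> k; rewrite [fibp k.+2]/= !hornerE /=; ring.
have -> : 1 = - (a * b) by rewrite pab opprK.
by rewrite -sab !exprS; ring.
Qed.

End Binet.

(** Serves the sums that start at k = 1: their term at 0 vanishes because F_0 = 0. *)
Lemma sum_nat_from1 (V : nmodType) (n : nat) (g : nat -> V) :
  g 0 = 0 -> \sum_(1 <= k < n.+1) g k = \sum_(0 <= k < n.+1) g k.
Proof. by move=> g0; rewrite [RHS]big_ltn // g0 add0r. Qed.

(** The exceptional points are 0 and four pairs y, -y; avoiding such a pair means x^2 - y^2 is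
    nonzero, with y^2 = 1, 1/2, -4, -2. *)
Lemma notin_exceptional (R : realType) (x : R[i]) :
  x \notin exceptional R ->
  [/\ x != 0, x ^+ 2 - 1 != 0, 2 * x ^+ 2 - 1 != 0, x ^+ 2 + 4 != 0
    & x ^+ 2 + 2 != 0].
Proof.
have i2 : 'i%C ^+ 2 = -1 :> R[i] by rewrite sqr_i.
have r2 : (Num.sqrt (2 : R))%:C%C ^+ 2 = 2.
  by rewrite -rmorphXn sqr_sqrtr ?ler0n // rmorph_nat.
have two_neq0 : (2 : R[i]) != 0 by rewrite pnatr_eq0.
have sqr_neq (y : R[i]) : x != y -> x != - y -> x ^+ 2 - y ^+ 2 != 0.
  by move=> ? ?; rewrite subr_eq0 eqf_sqr negb_or; apply/andP.
rewrite /exceptional !inE !negb_or.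
case/and5P=> x0 x1 xm1 xr /and5P[xmr xi xmi xir xmir]; split=> //.
- by rewrite -(expr1n _ 2); apply: sqr_neq.
- have := mulf_neq0 two_neq0 (sqr_neq _ xr xmr).
  by rewrite expr_div_n r2 expr1n mulrBr mul1r divff.
- by have := sqr_neq _ xi xmi; rewrite exprMn i2 mulrN1 opprK -natrX.
- by have := sqr_neq _ xir xmir; rewrite exprMn i2 r2 mulN1r opprK.
Qed.

Theorem theorem8 (R : realType) (n : nat) (x s t : R[i])
    (hs : s ^+ 2 = x ^+ 2 - 1) (ht : t ^+ 2 = x ^+ 2 + 4) :
  (x \notin exceptional R -> admissible x s t) /\
  (admissible x s t ->
    (* (1) *)
    (\sum_(0 <= k < n) 'C(n, k)%:R *
           (t * (2 * x ^+ 2 - 1) / x) ^ (n%:Z - k%:Z - 1) *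
           (1 - (-1) ^+ (n - k)) *
           (chebT (2 * k)).[x]
     =
     \sum_(1 <= k < n.+1) 'C(n, k)%:R *
           ((4 * x ^+ 2 - 2) / x) ^ (k%:Z - 1) *
           (2 * x * s) ^+ (n - k) *
           (1 + (-1) ^+ (n - k)) *
           (fibp k).[x]) /\
    (* (2) *)
    (\sum_(0 <= k < n.+1) 'C(n, k)%:R *
           (t * (2 * x ^+ 2 - 1) / x) ^ (n%:Z - k%:Z - 1) *
           (1 - (-1) ^+ (n - k)) *
           (chebU (2 * k)).[x]
     =
     2 * x * \sum_(1 <= k < n.+1) 'C(n, k)%:R *
           ((4 * x ^+ 2 - 2) / x) ^ (k%:Z - 1) *
           (2 * x * s) ^ (n%:Z - k%:Z - 1) *
           (alpha x s - (-1) ^+ (n - k) * beta x s) *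
           (fibp k).[x]) /\
    (* (3) *)
    (\sum_(0 <= k < n.+1) 'C(n, k)%:R *
           (t * (2 * x ^+ 2 - 1) / x) ^ (n%:Z - k%:Z - 1) *
           (1 - (-1) ^+ (n - k)) *
           (chebT (2 * k + 1)).[x]
     =
     \sum_(1 <= k < n.+1) 'C(n, k)%:R *
           ((4 * x ^+ 2 - 2) / x) ^ (k%:Z - 1) *
           (2 * x * s) ^+ (n - k) *
           (alpha x s + (-1) ^+ (n - k) * beta x s) *
           (fibp k).[x]) /\
    (* (4) *)
    (\sum_(0 <= k < n.+1) 'C(n, k)%:R *
           (t * (2 * x ^+ 2 - 1) / x) ^ (n%:Z - k%:Z - 1) *
           (1 - (-1) ^+ (n - k)) *
           (chebU (2 * k + 1)).[x]
     =
     2 * x * \sum_(1 <= k < n.+1) 'C(n, k)%:R *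
           ((4 * x ^+ 2 - 2) / x) ^ (k%:Z - 1) *
           (2 * x * s) ^ (n%:Z - k%:Z - 1) *
           (alpha x s ^+ 2 - (-1) ^+ (n - k) * beta x s ^+ 2) *
           (fibp k).[x]) /\
    (* (5) *)
    (x * \sum_(0 <= k < n.+1) 'C(n, k)%:R *
           ((x ^+ 2 + 2) / (2 * x)) ^+ k *
           (x * t / 2) ^ (n%:Z - k%:Z - 1) *
           (rho x t - (-1) ^+ (n - k) * sigma x t) *
           (chebT k).[x]
     =
     \sum_(0 <= k < n.+1) 'C(n, k)%:R *
           ((x ^+ 2 + 2) * s / (2 * x)) ^+ (n - k) *
           (1 + (-1) ^+ (n - k)) *
           (fibp (2 * k + 1)).[x]) /\
    (* (6) *)
    (x * \sum_(0 <= k < n.+1) 'C(n, k)%:R *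
           ((x ^+ 2 + 2) / (2 * x)) ^ (k%:Z - 1) *
           (x * t / 2) ^ (n%:Z - k%:Z - 1) *
           (rho x t - (-1) ^+ (n - k) * sigma x t) *
           (chebU k).[x]
     =
     \sum_(0 <= k < n.+1) 'C(n, k)%:R *
           ((x ^+ 2 + 2) * s / (2 * x)) ^ (n%:Z - k%:Z - 1) *
           (alpha x s - (-1) ^+ (n - k) * beta x s) *
           (fibp (2 * k + 1)).[x]) /\
    (* (7) *)
    (x * \sum_(0 <= k < n.+1) 'C(n, k)%:R *
           ((x ^+ 2 + 2) / (2 * x)) ^+ k *
           (x * t / 2) ^ (n%:Z - k%:Z - 1) *
           (1 - (-1) ^+ (n - k)) *
           (chebT k).[x]
     =
     \sum_(1 <= k < n.+1) 'C(n, k)%:R *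
           ((x ^+ 2 + 2) * s / (2 * x)) ^+ (n - k) *
           (1 + (-1) ^+ (n - k)) *
           (fibp (2 * k)).[x]) /\
    (* (8) *)
    (x * \sum_(0 <= k < n.+1) 'C(n, k)%:R *
           ((x ^+ 2 + 2) / (2 * x)) ^ (k%:Z - 1) *
           (x * t / 2) ^ (n%:Z - k%:Z - 1) *
           (1 - (-1) ^+ (n - k)) *
           (chebU k).[x]
     =
     \sum_(0 <= k < n.+1) 'C(n, k)%:R *
           ((x ^+ 2 + 2) * s / (2 * x)) ^ (n%:Z - k%:Z - 1) *
           (alpha x s - (-1) ^+ (n - k) * beta x s) *
           (fibp (2 * k)).[x]) /\
    (* (9) *)
    (x * \sum_(0 <= k < n.+1) 'C(n, k)%:R *
           ((x ^+ 2 + 2) / (4 * x ^+ 2 - 2)) ^+ k *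
           (x * t / 2) ^ (n%:Z - k%:Z - 1) *
           (1 - (-1) ^+ (n - k)) *
           (chebT (2 * k + 1)).[x]
     =
     \sum_(0 <= k < n.+1) 'C(n, k)%:R *
           (x * (x ^+ 2 + 2) * s / (2 * x ^+ 2 - 1)) ^+ (n - k) *
           (alpha x s + (-1) ^+ (n - k) * beta x s) *
           (fibp (2 * k)).[x]) /\
    (* (10) *)
    (\sum_(0 <= k < n.+1) 'C(n, k)%:R *
           ((x ^+ 2 + 2) / (4 * x ^+ 2 - 2)) ^ (k%:Z - 1) *
           (x * t / 2) ^ (n%:Z - k%:Z - 1) *
           (1 - (-1) ^+ (n - k)) *
           (chebU (2 * k + 1)).[x]
     =
     2 * \sum_(0 <= k < n.+1) 'C(n, k)%:R *
           (x * (x ^+ 2 + 2) * s / (2 * x ^+ 2 - 1)) ^ (n%:Z - k%:Z - 1) *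
           (alpha x s ^+ 2 - (-1) ^+ (n - k) * beta x s ^+ 2) *
           (fibp (2 * k)).[x]) /\
    (* (11) *)
    (x * \sum_(0 <= k < n.+1) 'C(n, k)%:R *
           ((x ^+ 2 + 2) / (4 * x ^+ 2 - 2)) ^+ k *
           (x * t / 2) ^ (n%:Z - k%:Z - 1) *
           (rho x t - (-1) ^+ (n - k) * sigma x t) *
           (chebT (2 * k)).[x]
     =
     \sum_(0 <= k < n.+1) 'C(n, k)%:R *
           (x * (x ^+ 2 + 2) * s / (2 * x ^+ 2 - 1)) ^+ (n - k) *
           (1 + (-1) ^+ (n - k)) *
           (fibp (2 * k + 1)).[x]) /\
    (* (12) *)
    (\sum_(0 <= k < n.+1) 'C(n, k)%:R *
           ((x ^+ 2 + 2) / (4 * x ^+ 2 - 2)) ^ (k%:Z - 1) *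
           (x * t / 2) ^ (n%:Z - k%:Z - 1) *
           (rho x t - (-1) ^+ (n - k) * sigma x t) *
           (chebU (2 * k)).[x]
     =
     2 * \sum_(0 <= k < n.+1) 'C(n, k)%:R *
           (x * (x ^+ 2 + 2) * s / (2 * x ^+ 2 - 1)) ^ (n%:Z - k%:Z - 1) *
           (alpha x s - (-1) ^+ (n - k) * beta x s) *
           (fibp (2 * k + 1)).[x])).
Proof.
have two_neq0 : (2 : R[i]) != 0 by rewrite pnatr_eq0.
have four_2 : 4 * x ^+ 2 - 2 = 2 * (2 * x ^+ 2 - 1) by ring.
split=> [/notin_exceptional[x0 s0 g0 t0 h0]|].
  (* The roots [s] and [t] are nonzero because their squares are. *)
  rewrite -hs expf_eq0 /= in s0; rewrite -ht expf_eq0 /= in t0.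
  rewrite /admissible four_2 !(mulf_eq0, invr_eq0, negb_or).
  by rewrite two_neq0 x0 s0 g0 t0 h0.
(* In names such as [v1_neq0] the letter is a scalar of [sum_binomial_exchange] and the number is
   the first identity of the family using it. *)
case/and5P=> x0 _ g0 _ /and5P[v1_neq0 z1_neq0 v5_neq0 u5_neq0].
case/and3P=> z5_neq0 u9_neq0 z9_neq0.
have s0 : s != 0 by move: z1_neq0; rewrite mulf_eq0 => /norP[].
have t0 : t != 0 by move: v1_neq0; rewrite -mulrA mulf_eq0 => /norP[].
have h0 : x ^+ 2 + 2 != 0 by move: u5_neq0; rewrite mulf_eq0 => /norP[].
have g4 : 4 * x ^+ 2 - 2 != 0 by rewrite four_2 mulf_neq0.
have nz := (two_neq0, x0, s0, t0, g0, g4, h0).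
have w1_neq0 : (4 * x ^+ 2 - 2) / x != 0.
  by rewrite mulf_neq0 ?invr_neq0.
have absum : alpha x s + beta x s = 2 * x by rewrite /alpha /beta; ring.
have absub : alpha x s - beta x s = 2 * s by rewrite /alpha /beta; ring.
have abprod : alpha x s * beta x s = 1.
  by rewrite /alpha /beta; ring: hs.
have a2 : alpha x s ^+ 2 = 2 * x ^+ 2 - 1 + 2 * x * s.
  by rewrite /alpha; ring: hs.
have b2 : beta x s ^+ 2 = 2 * x ^+ 2 - 1 - 2 * x * s.
  by rewrite /beta; ring: hs.
have rssum : rho x t + sigma x t = x by rewrite /rho /sigma; field.
have rssub : rho x t - sigma x t = t by rewrite /rho /sigma; field.
have rsprod : rho x t * sigma x t = - 1.
  by rewrite /rho /sigma; field: ht.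
have r2 : rho x t ^+ 2 = (x ^+ 2 + 2 + x * t) / 2.
  by rewrite /rho; field: ht.
have q2 : sigma x t ^+ 2 = (x ^+ 2 + 2 - x * t) / 2.
  by rewrite /sigma; field: ht.
(* These formulas dictate the weights used below. Over squared bases, (c, d) is (1, 1) for T_{2k},
   (alpha, beta) for T_{2k+1}, (alpha, -beta) for U_{2k} and (alpha^2, -beta^2) for U_{2k+1}; (e, f)
   is (1, 1) for F_{2k} and (rho, sigma) for F_{2k+1}. Over unsquared bases, T_k and F_k have
   weights (1, 1), and U_k has (alpha, -beta). *)
have TE k : (chebT k).[x] = (alpha x s ^+ k + beta x s ^+ k) / 2.
  by rewrite -(chebT_Binet absum abprod) mulrC mulKf.
have UE k : (chebU k).[x] =
    (alpha x s * alpha x s ^+ k - beta x s * beta x s ^+ k) / (2 * s).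
  by rewrite -!exprS -(chebU_Binet absum abprod) absub mulrC mulKf // mulf_neq0.
have FE k : (fibp k).[x] = (rho x t ^+ k - sigma x t ^+ k) / t.
  by rewrite -(fibp_Binet rssum rsprod) rssub mulrC mulKf.
(* The scalar [w] scales x/2, the part of rho without [t], to 2x^2 - 1, the part of alpha^2 without
   [s]. Then [v] is the [t]-part of w rho and [z] the [s]-part of alpha^2. *)
have exch1 := @sum_binomial_exchange _
  1 (t * (2 * x ^+ 2 - 1) / x) ((4 * x ^+ 2 - 2) / x)
  (2 * x * s) (alpha x s ^+ 2) (beta x s ^+ 2) (rho x t) (sigma x t).
move/(_ ltac:(by rewrite a2 /rho; field; rewrite ?nz)) in exch1.
move/(_ ltac:(by rewrite a2 /sigma; field; rewrite ?nz)) in exch1.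
move/(_ ltac:(by rewrite b2 /rho; field; rewrite ?nz)) in exch1.
move/(_ ltac:(by rewrite b2 /sigma; field; rewrite ?nz)) in exch1.
(* Now [u] scales x to (x^2 + 2)/2, the part of rho^2 without [t]; [v] is the [t]-part of rho^2 and
   z = us. *)
have exch5 := @sum_binomial_exchange _
  ((x ^+ 2 + 2) / (2 * x)) (x * t / 2) 1
  ((x ^+ 2 + 2) * s / (2 * x)) (alpha x s) (beta x s)
  (rho x t ^+ 2) (sigma x t ^+ 2).
move/(_ ltac:(by rewrite /alpha r2; field; rewrite ?nz)) in exch5.
move/(_ ltac:(by rewrite /alpha q2; field; rewrite ?nz)) in exch5.
move/(_ ltac:(by rewrite /beta r2; field; rewrite ?nz)) in exch5.
move/(_ ltac:(by rewrite /beta q2; field; rewrite ?nz)) in exch5.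
(* As before, but [u] scales 2x^2 - 1 instead of x, and z = 2xsu. *)
have exch9 := @sum_binomial_exchange _
  ((x ^+ 2 + 2) / (4 * x ^+ 2 - 2)) (x * t / 2) 1
  (x * (x ^+ 2 + 2) * s / (2 * x ^+ 2 - 1))
  (alpha x s ^+ 2) (beta x s ^+ 2) (rho x t ^+ 2) (sigma x t ^+ 2).
move/(_ ltac:(by rewrite a2 r2; field; rewrite ?nz)) in exch9.
move/(_ ltac:(by rewrite a2 q2; field; rewrite ?nz)) in exch9.
move/(_ ltac:(by rewrite b2 r2; field; rewrite ?nz)) in exch9.
move/(_ ltac:(by rewrite b2 q2; field; rewrite ?nz)) in exch9.
do !split; rewrite ?mulr_sumr ?sum_nat_from1 ?muln0 ?horner0 ?mulr0 //.
  (* The left sum of (1) stops at k = n - 1; its term at k = n would carry the factor 1 - 1 = 0 and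
     can be added. *)
  transitivity (\sum_(0 <= k < n.+1) 'C(n, k)%:R *
      (t * (2 * x ^+ 2 - 1) / x) ^ (n%:Z - k%:Z - 1) *
      (1 - (-1) ^+ (n - k)) * (chebT (2 * k)).[x]).
    by rewrite [RHS]big_nat_recr //= subnn expr0 !(subrr, mulr0, mul0r, addr0).
(* The last argument clears the denominators of the Binet formulas and of the
   exponents n - k - 1 and k - 1; it is the same on both sides. *)
all: [> apply: (exch1 n 1 1 1 1 (2 * (t * (2 * x ^+ 2 - 1) / x)))
|apply: (exch1 n (alpha x s) (- beta x s) 1 1
     (2 * s * (t * (2 * x ^+ 2 - 1) / x)))
|apply: (exch1 n (alpha x s) (beta x s) 1 1
     (2 * (t * (2 * x ^+ 2 - 1) / x)))
|apply: (exch1 n (alpha x s ^+ 2) (- beta x s ^+ 2) 1 1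
     (2 * s * (t * (2 * x ^+ 2 - 1) / x)))
|apply: (exch5 n 1 1 (rho x t) (sigma x t) t)
|apply: (exch5 n (alpha x s) (- beta x s) (rho x t) (sigma x t)
     (t * ((x ^+ 2 + 2) * s / (2 * x))))
|apply: (exch5 n 1 1 1 1 t)
|apply: (exch5 n (alpha x s) (- beta x s) 1 1
     (t * ((x ^+ 2 + 2) * s / (2 * x))))
|apply: (exch9 n (alpha x s) (beta x s) 1 1 t)
|apply: (exch9 n (alpha x s ^+ 2) (- beta x s ^+ 2) 1 1
     (t * (x * (x ^+ 2 + 2) * s / (2 * x ^+ 2 - 1)) / 2))
|apply: (exch9 n 1 1 (rho x t) (sigma x t) t)
|apply: (exch9 n (alpha x s) (- beta x s) (rho x t) (sigma x t)
     (t * (x * (x ^+ 2 + 2) * s / (2 * x ^+ 2 - 1)) / 2))].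
all: rewrite ?(mulf_eq0, invr_eq0, negb_or) ?nz //.
all: move=> k le_kn; rewrite ?exprz_subr1 ?exprz_pred //.
(* Even indices become powers of squares and odd ones shed one factor; [expr1n] removes the scalar
   equal to 1, which is [u] in (1)-(4) and [w] in (5)-(12). *)
all: rewrite ?TE ?UE ?FE ?addn1 ?[_ ^+ (2 * k).+1]exprS ?exprM ?expr1n.
all: by field; rewrite !nz.
Qed.
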